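(* Let $G=(V,E)$ be a finite connected graph. Then, for Lebesgue-almost every $Q\in\mathbb{R}^V$, every eigenvector of $H_Q=\Delta_G+Q$ has full support (i.e. all its coordinates are nonzero). In particular, $H_Q$ satisfies Condition (S) for almost every $Q$.
   Context: $G=(V,E)$ is a finite simple undirected graph. Its combinatorial Laplacian is $\Delta_G u(j)=\sum_{k\sim j}(u(j)-u(k))$. A potential $Q\in\mathbb{R}^V$ is identified with the diagonal operator $(Qu)(j)=Q(j)u(j)$. Condition (S) for $H_Q$, with real orthonormal eigenbasis $(\phi_k)_{k=1}^n$: for every pair $k\neq\ell$ there is $j\in V$ with $\phi_k(j)\phi_\ell(j)\neq0$. *)

(* Defs.v *)
From HB Require Import structures.
From mathcomp Require Import all_boot all_order all_algebra.
From mathcomp Require Import all_classical all_reals all_analysis.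
From mathcomp Require Import complex.
Set Implicit Arguments.
Unset Strict Implicit.
Unset Printing Implicit Defensive.
Import Order.TTheory GRing.Theory Num.Theory.
Import numFieldNormedType.Exports.
Local Open Scope classical_set_scope.
Local Open Scope ring_scope.

Section tuple_cons.
Variables (R : realType) (n : nat).
Local Notation RB := (measurableTypeR R).

Definition tuple_cons (x : RB * n.-tuple RB) : n.+1.-tuple RB :=
  [tuple of x.1 :: x.2].

Lemma measurable_tuple_cons : measurable_fun setT tuple_cons.
Proof. exact: measurable_cons. Qed.

HB.instance Definition _ := isMeasurableFun.Build _ _ _ _ tuple_cons
  measurable_tuple_cons.

Definition tuple_uncons (t : n.+1.-tuple RB) : RB * n.-tuple RB :=
  (thead t, [tuple of behead t]).

Lemma measurable_tuple_uncons : measurable_fun setT tuple_uncons.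
Proof.
apply/measurable_fun_pairP; split; last exact: measurable_behead.
exact: (measurable_tnth (T := RB) ord0).
Qed.

Lemma tuple_consK : cancel tuple_cons tuple_uncons.
Proof. by move=> [x t]; congr pair; apply/val_inj. Qed.

End tuple_cons.

Section lebesgue_tuple_step.
Variables (R : realType) (n : nat).
Local Notation RB := (measurableTypeR R).
Variable mu : {sigma_finite_measure set (n.-tuple RB) -> \bar R}.
Local Open Scope ereal_scope.

Definition lebesgue_tuple_step : set (n.+1.-tuple RB) -> \bar R :=
  pushforward (@lebesgue_measure R \x mu) (@tuple_cons R n).

Let step0 : lebesgue_tuple_step set0 = 0.
Proof. exact: measure0. Qed.

Let step_ge0 A : 0 <= lebesgue_tuple_step A.
Proof. exact: measure_ge0. Qed.

Let step_sigma_additive : semi_sigma_additive lebesgue_tuple_step.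
Proof. exact: measure_semi_sigma_additive. Qed.

HB.instance Definition _ := isMeasure.Build _ _ _ lebesgue_tuple_step
  step0 step_ge0 step_sigma_additive.

Let step_sigma_finite : sigma_finite setT lebesgue_tuple_step.
Proof.
have /sigma_finiteP[F [FT ndF Foo]] := sigma_finiteT (@lebesgue_measure R).
have /sigma_finiteP[G [GT ndG Goo]] := sigma_finiteT mu.
exists (fun k => @tuple_uncons R n @^-1` (F k `*` G k)).
  apply/esym; rewrite -subTset => t _.
  have : setT (tuple_uncons t).1 by [].
  have : setT (tuple_uncons t).2 by [].
  rewrite FT GT => -[k _ Gk] [l _ Fl]; exists (maxn k l) => //; split.
    exact: (subsetPset _ _ (ndF _ _ (leq_maxr k l))).
  exact: (subsetPset _ _ (ndG _ _ (leq_maxl k l))).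
move=> k; have [mF Fk] := Foo k; have [mG Gk] := Goo k; split.
  rewrite -[X in measurable X]setTI; apply: measurable_tuple_uncons => //.
  exact: measurableX.
rewrite /lebesgue_tuple_step /pushforward.
rewrite (_ : _ @^-1` _ = F k `*` G k); last first.
  by rewrite -comp_preimage (_ : _ \o _ = id)//; apply/funext/tuple_consK.
by rewrite product_measure1E// lte_mul_pinfty// ge0_fin_numE.
Qed.

HB.instance Definition _ := Measure_isSigmaFinite.Build _ _ _
  lebesgue_tuple_step step_sigma_finite.

End lebesgue_tuple_step.

(* Lebesgue measure on R^n, i.e. the n-fold product of Lebesgue measure on R;
   see [lebesgue_tuple_box] for its values on boxes. *)
Fixpoint lebesgue_tuple (R : realType) (n : nat) :
    {sigma_finite_measure set (n.-tuple (measurableTypeR R)) -> \bar R} :=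
  match n with
  | 0%N => \d_([tuple] : 0.-tuple (measurableTypeR R))
  | m.+1 => lebesgue_tuple_step (lebesgue_tuple R m)
  end.

Lemma measurable_tuple_box (R : realType) (n : nat)
    (A : 'I_n -> set (measurableTypeR R)) :
  (forall i, measurable (A i)) ->
  measurable [set t : n.-tuple (measurableTypeR R) | forall i, A i (tnth t i)].
Proof.
move=> mA; rewrite (_ : [set _ | _] =
    \bigcap_(i in [set: 'I_n]) ((@tnth n (measurableTypeR R))^~ i @^-1` A i)).
  apply: (@fin_bigcap_measurable _ (n.-tuple (measurableTypeR R))) => [|i _].
    exact: finite_finset.
  by rewrite -[X in measurable X]setTI; exact: measurable_tnth.
by apply/seteqP; split=> t At i; [move=> _|]; exact: At.
Qed.

Lemma lebesgue_tuple_box (R : realType) (n : nat)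
    (A : 'I_n -> set (measurableTypeR R)) :
  (forall i, measurable (A i)) ->
  lebesgue_tuple R n [set t | forall i, A i (tnth t i)] =
  (\prod_(i < n) lebesgue_measure (A i))%E.
Proof.
elim: n A => [|n IHn] A mA.
  by rewrite big_ord0 /= diracE mem_set// => -[].
rewrite big_ord_recl -IHn; last by move=> i; exact: mA.
rewrite -product_measure1E//; last first.
  by apply: (@measurable_tuple_box R n (fun i => A (lift ord0 i))) => i; exact: mA.
rewrite /= /lebesgue_tuple_step /pushforward; congr (_ _).
apply/seteqP; split => -[x t] /=.
  move=> h; split; first exact: (h ord0).
  by move=> i; have := h (lift ord0 i); rewrite tnthS.
move=> [hx ht] i; case: (unliftP ord0 i) => [j|] ->//.
by rewrite tnthS.
Qed.

(* R^V is identified with R^#|V| through the enumeration of V *)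
Definition lebesgue_ae (R : realType) (V : finType) (P : (V -> R) -> Prop) :
    Prop :=
  \forall t \ae lebesgue_tuple R #|V|, P (fun v => tnth t (enum_rank v)).

Section schrodinger.
Variables (F : pzRingType) (V : finType).
Implicit Types (u : {ffun V -> F}) (H : {ffun V -> F} -> {ffun V -> F}).

Definition laplacian (e : rel V) u : {ffun V -> F} :=
  [ffun j => \sum_(k | e j k) (u j - u k)].

Definition schrodinger (e : rel V) (Q : V -> F) u : {ffun V -> F} :=
  [ffun j => laplacian e u j + Q j * u j].

Definition is_eigenvector H u : Prop :=
  u != 0 /\ exists lam : F, forall j, H u j = lam * u j.

Definition full_support u : Prop := forall j, u j != 0.

(* #|V| orthonormal vectors of F^V necessarily form a basis when F is a field *)
Definition orthonormal_eigenbasis H (phi : 'I_#|V| -> {ffun V -> F}) : Prop :=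
  (forall k l, \sum_j phi k j * phi l j = (k == l)%:R) /\
  (forall k, is_eigenvector H (phi k)).

(* Real orthonormal eigenbases always exist for the operators considered here,
   but they are not unique: the condition is required of each of them. *)
Definition condition_S H : Prop :=
  forall phi, orthonormal_eigenbasis H phi ->
  forall k l, k != l -> exists j, phi k j * phi l j != 0.

End schrodinger.

(* H_Q on complex-valued functions *)
Definition schrodingerC (R : realType) (V : finType) (e : rel V) (Q : V -> R) :
    {ffun V -> R[i]} -> {ffun V -> R[i]} :=
  schrodinger e (fun j => (Q j)%:C%C).

(* Main.v *)
(* An eigenvector u of H_Q with u(j) = 0 satisfies (H_Q^k u)(j) = lam^k u(j) = 0
   for all k, so the Krylov matrix with rows e_j^T H_Q^k, k < #|V|, is singular.
   Its determinant is a polynomial in the values of Q, and the zero set of a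
   nonzero polynomial is Lebesgue-null by Fubini. To find a Q at which the
   determinant does not vanish, connectedness is used to grow a vertex set S
   from {j} to V one neighbour v at a time, keeping the property that no
   eigenvector of the block of H_Q indexed by S vanishes at j: each step only
   excludes finitely many values of Q(v). *)
Require Import Defs.
From mathcomp Require Import all_boot all_order all_algebra.
From mathcomp Require Import all_classical all_reals all_analysis.
From mathcomp Require Import complex.
Set Implicit Arguments.
Unset Strict Implicit.
Unset Printing Implicit Defensive.
Import Order.TTheory GRing.Theory Num.Theory.
Local Open Scope ring_scope.

(** * Observability of blocks and its extension by one vertex *)

(* Vectors supported in [S] stand for vectors indexed by [S]: no eigenvector of
   the block of [B] indexed by [S] vanishes at [j]. *)
Definition observable (F : pzRingType) (n : nat) (B : 'M[F]_n) (j : 'I_n)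
    (S : {set 'I_n}) : Prop :=
  forall lam (u : 'cV[F]_n), (forall k, k \notin S -> u k 0 = 0) ->
    (forall k, k \in S -> (B *m u) k 0 = lam * u k 0) -> u j 0 = 0 -> u = 0.

Lemma char_poly_mx_mulE (R : comNzRingType) n (B : 'M[R]_n)
    (y : 'cV[{poly R}]_n) k :
  (char_poly_mx B *m y) k 0 = 'X * y k 0 - \sum_l (B k l)%:P * y l 0.
Proof.
rewrite mulmxBl mul_scalar_mx !mxE; congr (_ - _).
by apply: eq_bigr => l _; rewrite mxE.
Qed.

(** At an entry of [y] of maximal degree, the factor ['X] raises the degree by one, and the constant
    entries of [B] produce nothing of that degree to cancel it. *)
Lemma size_char_poly_mx_mul (R : idomainType) n (B : 'M[R]_n)
    (y : 'cV[{poly R}]_n) :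
  y != 0 -> exists k, (1 < size ((char_poly_mx B *m y) k 0%R))%N.
Proof.
move=> y0.
have /cV0Pn[i yi0] := y0.
have [|k Nk] := @bigop.eq_bigmax _ (fun l => size (y l 0)).
  by apply/card_gt0P; exists i.
have yk l : (size (y l 0%R) <= size (y k 0%R))%N.
  by rewrite -Nk bigop.leq_bigmax.
have yk0 : y k 0 != 0.
  by rewrite -size_poly_gt0 (leq_trans _ (yk i))// size_poly_gt0.
exists k; rewrite char_poly_mx_mulE size_polyDl mulrC size_mulX//.
  by rewrite ltnS size_poly_gt0.
rewrite size_polyN ltnS (leq_trans (size_sum _ _ _))//.
apply/bigmax_leqP => l _; rewrite mul_polyC.
exact: leq_trans (size_scale_leq _ _) (yk l).
Qed.

(* Descent on the degree of [d]: at a root of [d] the vector [y] specializes to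
   an eigenvector of [B] vanishing at [j], hence to [0], so that the linear
   factor can be cancelled; once [d] is constant the degrees do not match. *)
Lemma observable_char_poly_mx (F : closedFieldType) n (B : 'M[F]_n) (j : 'I_n)
    (S : {set 'I_n}) (a : 'cV[F]_n) (d : {poly F}) (y : 'cV[{poly F}]_n) :
  observable B j S -> (forall k, k \notin S -> y k 0 = 0) -> y j 0 = 0 ->
  char_poly_mx B *m y = d *: map_mx polyC a -> d != 0 -> a = 0.
Proof.
move=> obsB; have [m] := ubnP (size d); elim: m => // m IHm in d y *.
move=> dm yS yj yd d0.
have [/eqP/size_poly1P[c c0 dE]|/closed_rootP[lam dlam]] := eqVneq (size d) 1%N.
  have [y0|/(size_char_poly_mx_mul B)[k]] := eqVneq y 0.
    move/colP: yd => yd; apply/colP => k; move/eqP: (yd k).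
    rewrite y0 mulmx0 !mxE dE eq_sym mulf_eq0 !polyC_eq0 (negbTE c0)/=.
    by move/eqP.
  rewrite yd !mxE dE -polyCM => /leq_trans/(_ (size_polyC_leq1 _)).
  by [].
have ylam : map_mx (horner_eval lam) y = 0.
  apply: (obsB lam).
  - by move=> k kS; rewrite mxE yS// /horner_eval horner0.
  - move=> k kS; apply/eqP; rewrite eq_sym -subr_eq0.
    move/matrixP/(_ k 0)/(congr1 (horner_eval lam)): yd.
    rewrite char_poly_mx_mulE !mxE /horner_eval !hornerE (rootP dlam) mul0r.
    move=> yd.
    rewrite -[X in _ == X]yd horner_sum; apply/eqP; congr (_ - _).
    by apply: eq_bigr => l _; rewrite !mxE !hornerE.
  - by rewrite mxE yj /horner_eval horner0.
have Xlam0 : 'X - lam%:P != 0 by rewrite polyXsubC_eq0.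
have /factor_theorem[d' dE] := dlam.
pose y' := map_mx (fun p => p %/ ('X - lam%:P)) y.
have yE : y = ('X - lam%:P) *: y'.
  apply/colP => k; rewrite !mxE mulrC divpK// dvdp_XsubCl.
  by move/colP/(_ k): ylam; rewrite !mxE => /rootP.
have d'0 : d' != 0 by apply: contraNneq d0 => d'0; rewrite dE d'0 mul0r.
apply: (IHm d' y') => //.
- rewrite -ltnS (leq_trans _ dm)// dE size_Mmonic ?monicXsubC//.
  by rewrite size_XsubC addn2.
- by move=> k kS; rewrite mxE yS// div0p.
- by rewrite mxE yj div0p.
- move: yd; rewrite yE dE [d' * _]mulrC -scalerA -scalemxAr => /eqP.
  rewrite -subr_eq0 -scalerBr scalemx_eq0 (negbTE Xlam0)/= subr_eq0.
  by move/eqP.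
Qed.

(** By Cramer's rule, [adj(lam - B) a = det(lam - B) w]. So [w j 0 = 0] makes [lam] a root of entry
    [j] of [adj(X - B) a], a polynomial that observability forces to be nonzero. *)
Lemma resolvent_finite (F : closedFieldType) n (B : 'M[F]_n) (j : 'I_n)
    (S : {set 'I_n}) (a : 'cV[F]_n) :
  observable B j S -> (forall k l, k \notin S -> B k l = 0) ->
  (forall k, k \notin S -> a k 0 = 0) -> j \in S -> a != 0 ->
  exists rs : seq F, forall lam (w : 'cV[F]_n), w j 0 = 0 ->
    lam *: w - B *m w = a -> lam \in rs.
Proof.
move=> obsB BS aS jS a0.
pose y := \adj (char_poly_mx B) *m map_mx polyC a.
have yE : char_poly_mx B *m y = char_poly B *: map_mx polyC a.
  by rewrite mulmxA mul_mx_adj mul_scalar_mx.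
have yS k : k \notin S -> y k 0 = 0.
  (* Off [S] both [B] and [a] vanish, so row [k] of [yE] reads ['X * y k 0 = 0]. *)
  move=> kS; move/matrixP/(_ k 0)/eqP: yE.
  rewrite char_poly_mx_mulE big1 => [|l _]; last by rewrite BS// mul0r.
  by rewrite subr0 !mxE aS// mulr0 mulf_eq0 polyX_eq0/= => /eqP.
have yj : y j 0 != 0.
  apply: contra_neq a0 => yj.
  apply: (observable_char_poly_mx obsB yS yj yE).
  by rewrite monic_neq0// char_poly_monic.
have [rs rsE] := closed_field_poly_normal (y j 0).
exists rs => lam w wj wE.
have lc0 : lead_coef (y j 0) != 0 by rewrite lead_coef_eq0.
rewrite -root_prod_XsubC -(rootZ lam _ lc0) -rsE.
apply/rootP.
have -> : (y j 0).[lam] = (map_mx (horner_eval lam) y) j 0 by rewrite [RHS]mxE.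
rewrite map_mxM map_mx_adj -map_mx_comp.
have -> : map_mx (horner_eval lam \o polyC) a = a.
  by apply/matrixP => k l; rewrite mxE /= /horner_eval hornerC.
have -> : map_mx (horner_eval lam) (char_poly_mx B) = lam%:M - B.
  apply/matrixP => k l; rewrite !mxE /horner_eval !hornerE.
  by case: eqP => _ //=; rewrite ?mulr1n ?mulr0n !hornerE.
rewrite -wE -mul_scalar_mx -mulmxBl mulmxA mul_adj_mx mul_scalar_mx.
by rewrite mxE wj mulr0.
Qed.

(* An eigenvector [u] of the enlarged block with [u j = 0] has [u v != 0], by
   observability on [S]; normalized by [u v = 1], its restriction [w] to [S]
   solves [(lam - B) w = a] with [a] the column [v] of [B]. This leaves finitely
   many [lam], each [lam] determines [w], and row [v] then determines [q]. *)
Lemma observable_step (F : closedFieldType) n (B : 'M[F]_n) (j k0 v : 'I_n)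
    (S : {set 'I_n}) :
  observable B j S -> j \in S -> k0 \in S -> v \notin S -> B k0 v != 0 ->
  exists rs : seq F, forall q, q \notin rs ->
    observable (B + q *: delta_mx v v) j (v |: S).
Proof.
move=> obsB jS k0S vS Bk0v.
(* Rows off [S] are zeroed to meet the support hypothesis of [resolvent_finite]; observability on
   [S] only reads the rows in [S]. *)
pose BS := \matrix_(k, l) if k \in S then B k l else 0.
pose a : 'cV[F]_n := \col_k if k \in S then B k v else 0.
have obsBS : observable BS j S.
  move=> lam u uS uE; apply: (obsB lam) => // k kS.
  by rewrite -uE// !mxE; apply: eq_bigr => l _; rewrite !mxE kS.
have [||//||rs0 rs0P] := @resolvent_finite _ _ BS j S a obsBS.
- by move=> k l /negbTE kS; rewrite mxE kS.
- by move=> k /negbTE kS; rewrite mxE kS.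
- by apply/cV0Pn; exists k0; rewrite mxE k0S.
pose C lam := [set w : 'cV[F]_n | [/\ forall k, k \notin S -> w k 0 = 0,
  w j 0 = 0 & lam *: w - BS *m w = a]]%classic.
have CU lam w w' : C lam w -> C lam w' -> w = w'.
  move=> [wS wj wE] [w'S w'j w'E]; apply/eqP; rewrite -subr_eq0; apply/eqP.
  have BwE x : lam *: x - BS *m x = a -> BS *m x = lam *: x - a.
    by move=> <-; rewrite subKr.
  apply: (obsBS lam) => [k kS|k kS|].
  - by rewrite !mxE wS// w'S// subrr.
  - by rewrite mulmxBr (BwE w wE) (BwE w' w'E) opprB addrA subrK -scalerBr mxE.
  - by rewrite !mxE wj w'j subrr.
pose g lam := lam - B v v - (B *m xget 0 (C lam)) v 0.
exists (map g rs0) => q qrs lam u uS uE uj.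
have dE k : ((q *: delta_mx v v) *m u) k 0 = if k == v then q * u v 0 else 0.
  rewrite -scalemxAl [LHS]mxE mxE (bigD1 v)//= big1 => [|l lv]; last first.
    by rewrite mxE (negbTE lv) andbF mul0r.
  rewrite mxE eqxx andbT addr0.
  by case: eqVneq => _; rewrite ?mul1r ?mul0r ?mulr0.
have [uv|uv] := eqVneq (u v 0) 0.
  apply: (obsB lam) => // [k kS|k kS].
    by have [->//|kv] := eqVneq k v; apply: uS; rewrite !inE negb_or kv.
  have := uE k; rewrite !inE kS orbT => <-//.
  by rewrite mulmxDl [RHS]mxE dE uv mulr0 if_same addr0.
pose w : 'cV[F]_n := \col_k if k \in S then (u v 0)^-1 * u k 0 else 0.
have uwE : u = u v 0 *: (w + delta_mx v 0).
  apply/colP => k; rewrite !mxE eqxx andbT.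
  have [kS|kS] := boolP (k \in S).
    have /negbTE -> : k != v by apply: contraNneq vS => <-.
    by rewrite addr0 mulVKf.
  rewrite add0r; have [->|kv] := eqVneq k v; first by rewrite mulr1.
  by rewrite mulr0 uS// !inE negb_or kv.
have BuE k : (B *m u) k 0 = u v 0 * ((B *m w) k 0 + B k v).
  rewrite [in LHS]uwE -scalemxAr [LHS]mxE mulmxDr [X in _ * X]mxE.
  congr (_ * (_ + _)).
  by rewrite -colE mxE.
have Cw : C lam w.
  split.
  - by move=> k /negbTE kS; rewrite mxE kS.
  - by rewrite mxE jS uj mulr0.
  - apply/colP => k; rewrite [LHS]mxE [X in _ + X]mxE [RHS]mxE.
    have [kS|kS] := boolP (k \in S); last first.
      rewrite !mxE (negbTE kS) mulr0 sub0r big1 ?oppr0// => l _.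
      by rewrite !mxE (negbTE kS) mul0r.
    have kv : k != v by apply: contraNneq vS => <-.
    have -> : (BS *m w) k 0 = (B *m w) k 0.
      by rewrite !mxE; apply: eq_bigr => l _; rewrite [BS _ _]mxE kS.
    have := uE k; rewrite !inE kS orbT => /(_ isT).
    rewrite mulmxDl mxE dE (negbTE kv) addr0 BuE.
    move/(congr1 (fun x => (u v 0)^-1 * x)); rewrite mulKf// mulrCA => kE.
    by rewrite [(lam *: w) _ _]mxE [w k 0]mxE kS -kE [_ + B k v]addrC addrK.
have lamrs : lam \in rs0 by case: Cw => _ wj wE; exact: rs0P wj wE.
have xw : xget 0 (C lam) = w.
  exact: CU (xgetI 0 Cw) Cw.
move/negP: qrs; case; apply/mapP; exists lam => //; rewrite /g xw.
have := uE v; rewrite !inE eqxx mulmxDl mxE dE eqxx BuE => /(_ isT) vE.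
apply: (mulfI uv); rewrite !mulrBr [_ * lam]mulrC -vE mulrDr [q * _]mulrC.
by rewrite -addrA -opprD [_ * B v v + _]addrC addrAC subrr add0r.
Qed.

(** * Growing the vertex set from one vertex to all of them *)

Lemma natr_notin (R : numDomainType) (rs : seq R) :
  exists m : nat, m%:R \notin rs.
Proof.
have [/allP h|/allPn[_ /mapP[m _ ->] mrs]] :=
  boolP (all (mem rs) [seq m%:R | m <- iota 0 (size rs).+1]); last by exists m.
suff : (size rs < size rs)%N by rewrite ltnn.
rewrite -[X in (X <= _)%N](size_iota 0) -(size_map (fun m => m%:R : R)).
apply: uniq_leq_size h.
by rewrite map_inj_uniq ?iota_uniq//; move=> x y /eqP; rewrite eqr_nat => /eqP.
Qed.

(** Induction on the size of [S]. The potential takes natural values so that, although found over an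
    algebraically closed field, it descends to the reals. *)
Lemma exists_observable (F : numClosedFieldType) n (A : 'M[F]_n) (j : 'I_n) :
  (forall S : {set 'I_n}, j \in S -> S != [set: 'I_n] ->
     exists k v, [/\ k \in S, v \notin S & A k v != 0]) ->
  exists Q : 'I_n -> nat,
    observable (A + diag_mx (\row_i (Q i)%:R)) j [set: 'I_n].
Proof.
move=> Aconn.
suff /(_ n.-1)[|S [Q [jS cardS obsS]]] : forall m : nat, (m < n)%N ->
    exists (S : {set 'I_n}) (Q : 'I_n -> nat), [/\ j \in S, #|S| = m.+1 &
      observable (A + diag_mx (\row_i (Q i)%:R)) j S].
- by rewrite ltn_predL (leq_ltn_trans _ (ltn_ord j)).
- have ST : S = [set: 'I_n].
    apply/eqP; rewrite eqEcard finset.subsetT cardsT card_ord cardS /=.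
    by rewrite prednK// (leq_ltn_trans _ (ltn_ord j)).
  by exists Q; rewrite -ST.
elim=> [|m IHm] mn.
  (* A vector supported in [{j}] and vanishing at [j] is zero. *)
  exists [set j], (fun=> 0%N); rewrite set11 cards1; split=> // lam u uS _ uj.
  apply/colP => k; rewrite mxE; have [->//|kj] := eqVneq k j.
  by apply: uS; rewrite inE.
have [S [Q [jS cardS obsS]]] := IHm (ltnW mn).
have [k [v [kS vS Akv]]] : exists k v, [/\ k \in S, v \notin S & A k v != 0].
  apply: Aconn => //; apply: contraTneq mn => ST.
  by rewrite -cardS ST cardsT card_ord ltnn.
have kv : k != v by apply: contraNneq vS => <-.
have [|rs rsP] := observable_step obsS jS kS vS.
  by rewrite !mxE (negbTE kv) mulr0n addr0.
have [q qrs] := natr_notin rs.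
exists (v |: S), (fun i => (Q i + q * (i == v))%N); split.
- by rewrite !inE jS orbT.
- by rewrite cardsU1 vS cardS.
- suff -> : diag_mx (\row_i (Q i + q * (i == v))%:R) =
      diag_mx (\row_i (Q i)%:R) + (q%:R : F) *: delta_mx v v.
    by rewrite addrA; exact: rsP.
  apply/matrixP => i l; rewrite !mxE natrD natrM.
  case: (eqVneq i l) => [<-|il]; rewrite ?mulr1n ?mulr0n ?andbb//.
  case: eqVneq => [iv|_]; rewrite ?mulr0 ?addr0//=.
  by rewrite eq_sym -iv (negbTE il) mulr0 addr0.
Qed.

(** * Krylov determinants and eigenvectors vanishing at a coordinate *)

Definition krylov_mx (R : pzRingType) n (M : 'M[R]_n) (j : 'I_n) : 'M[R]_n :=
  \matrix_(k, i) (M ^+ k) j i.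

Lemma map_krylov_mx (R K : pzRingType) (f : {rmorphism R -> K}) n
    (M : 'M[R]_n) j : map_mx f (krylov_mx M j) = krylov_mx (map_mx f M) j.
Proof.
by apply/matrixP => k i; rewrite !mxE -rmorphXn mxE.
Qed.

Lemma det_krylov_eq0 (R : idomainType) n (M : 'M[R]_n) (j : 'I_n) lam
    (u : 'cV[R]_n) :
  M *m u = lam *: u -> u j 0 = 0 -> u != 0 -> \det (krylov_mx M j) = 0.
Proof.
move=> uE uj u0; apply/eqP; rewrite -det_tr; apply/det0P.
exists u^T; first by rewrite -trmx_eq0 trmxK.
rewrite -trmx_mul; apply/eqP; rewrite -trmx_eq0 trmxK; apply/eqP/colP => k.
have powu m : M ^+ m *m u = lam ^+ m *: u.
  elim: m => [|m IHm]; first by rewrite !expr0 mul1mx scale1r.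
  by rewrite exprSr -mulmxA uE -scalemxAr IHm scalerA exprS.
have -> : (krylov_mx M j *m u) k 0 = (M ^+ k *m u) j 0.
  by rewrite !mxE; apply: eq_bigr => i _; rewrite mxE.
by rewrite powu !mxE uj mulr0.
Qed.

(** If the determinant were zero, a kernel vector would have all its images under polynomials in [M]
    vanish at [j]. Applying the linear factors of the characteristic polynomial one by one then
    meets an eigenvector vanishing at [j]. *)
Lemma det_krylov_neq0 (F : closedFieldType) n (M : 'M[F]_n) (j : 'I_n) :
  observable M j [set: 'I_n] -> \det (krylov_mx M j) != 0.
Proof.
case: n => [|n] in M j *; first by case: j.
move=> obsM; apply/negP; rewrite -det_tr => /det0P[v v0 vK].
(* The bound means degree below the dimension: only powers of [M] that give rows of the Krylov
   matrix occur. *)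
have Kv (p : {poly F}) : (size p <= n.+1)%N -> (horner_mx M p *m v^T) j 0 = 0.
  move=> pn.
  rewrite -[p]coefK poly_def rmorph_sum mulmx_suml summxE big1//= => k _.
  rewrite -mul_polyC rmorphM rmorphXn /= horner_mx_C horner_mx_X -mulmxA.
  rewrite mul_scalar_mx mxE.
  have kn : (k < n.+1)%N := leq_trans (ltn_ord k) pn.
  move/matrixP/(_ 0 (Ordinal kn)): vK; rewrite [RHS]mxE => vK.
  suff -> : (M ^+ k *m v^T) j 0 = 0 by rewrite mulr0.
  rewrite -[RHS]vK !mxE.
  by apply: eq_bigr => i _; rewrite !mxE mulrC.
pose U (u : 'cV[F]_n.+1) := forall p, (horner_mx M p *m u) j 0 = 0.
have Uv : U v^T.
  (* Reduction modulo the characteristic polynomial removes the degree bound. *)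
  move=> p; rewrite (divp_eq p (char_poly M)) rmorphD rmorphM /=.
  rewrite Cayley_Hamilton mulr0 add0r; apply: Kv.
  by rewrite -ltnS -(size_char_poly M) ltn_modp monic_neq0// char_poly_monic.
have [rs rsE] := closed_field_poly_normal (char_poly M).
have := Cayley_Hamilton M.
rewrite rsE (monicP (char_poly_monic M)) scale1r rmorph_prod => Mrs.
have : v^T != 0 by rewrite -trmx_eq0 trmxK.
have : (\prod_(z <- rs) horner_mx M ('X - z%:P)) *m v^T = 0.
  by rewrite Mrs mul0mx.
(* The vector is generalized so that [u] can be replaced by [(M - z) u]; if that is zero, [u] itself
   is the forbidden eigenvector. *)
move: Uv; move: v^T; elim/last_ind: rs {rsE Mrs} => [|rs z IHrs] u Uu.
  by rewrite big_nil mul1mx => ->; rewrite eqxx.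
rewrite big_rcons /= -mulmxA => rsu u0.
pose u' := horner_mx M ('X - z%:P) *m u.
have Uu' : U u'.
  by move=> p; rewrite mulmxA -[_ *m horner_mx _ _]rmorphM; exact: Uu.
have [u'0|] := eqVneq u' 0; last exact: IHrs rsu.
move/eqP: u0; apply; apply: (obsM z) => [k|k _|]; first by rewrite inE.
  suff -> : M *m u = z *: u by rewrite mxE.
  move: u'0.
  rewrite /u' rmorphB /= horner_mx_X horner_mx_C mulmxBl mul_scalar_mx.
  exact: subr0_eq.
by have := Uu 1; rewrite rmorph1 mul1mx.
Qed.

(** * Polynomial functions on tuples and the measure of their zero sets *)

Local Open Scope classical_set_scope.

(** The inductive closure turns measurability and restriction to sections into structural
    inductions. *)
Inductive polyfun (R : realType) (n : nat) :
    (n.-tuple (measurableTypeR R) -> R) -> Prop :=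
| polyfun_cst c : polyfun (fun=> c)
| polyfun_tnth i : polyfun (fun t => tnth t i)
| polyfunD f g : polyfun f -> polyfun g -> polyfun (fun t => f t + g t)
| polyfunM f g : polyfun f -> polyfun g -> polyfun (fun t => f t * g t).

Section polyfun_theory.
Variables (R : realType) (n : nat).
Implicit Type f : n.-tuple (measurableTypeR R) -> R.

Lemma polyfun_sum I (r : seq I) (P : pred I)
    (F : I -> n.-tuple (measurableTypeR R) -> R) :
  (forall i, polyfun (F i)) -> polyfun (fun t => \sum_(i <- r | P i) F i t).
Proof.
move=> pF; elim: r => [|i r IHr].
  rewrite (_ : (fun _ => _) = fun=> 0); first exact: polyfun_cst.
  by apply/funext => t; rewrite big_nil.
rewrite (_ : (fun _ => _) = fun t =>
  (if P i then F i t else 0) + \sum_(i <- r | P i) F i t).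
  by apply: polyfunD IHr; case: (P i) => //; exact: polyfun_cst.
by apply/funext => t; rewrite big_cons; case: (P i); rewrite ?add0r.
Qed.

Lemma polyfun_prod I (r : seq I) (P : pred I)
    (F : I -> n.-tuple (measurableTypeR R) -> R) :
  (forall i, polyfun (F i)) -> polyfun (fun t => \prod_(i <- r | P i) F i t).
Proof.
move=> pF; elim: r => [|i r IHr].
  rewrite (_ : (fun _ => _) = fun=> 1); first exact: polyfun_cst.
  by apply/funext => t; rewrite big_nil.
rewrite (_ : (fun _ => _) = fun t =>
  (if P i then F i t else 1) * \prod_(i <- r | P i) F i t).
  by apply: polyfunM IHr; case: (P i) => //; exact: polyfun_cst.
by apply/funext => t; rewrite big_cons; case: (P i); rewrite ?mul1r.
Qed.

Lemma polyfun_det m (A : n.-tuple (measurableTypeR R) -> 'M[R]_m) :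
  (forall i k, polyfun (fun t => A t i k)) -> polyfun (fun t => \det (A t)).
Proof.
move=> pA; apply: polyfun_sum => s; apply: polyfunM; first exact: polyfun_cst.
exact: polyfun_prod.
Qed.

Lemma measurable_polyfun f :
  polyfun f -> measurable_fun setT (f : _ -> measurableTypeR R).
Proof.
elim=> {f}[c|i|f g _ mf _ mg|f g _ mf _ mg].
- exact: measurable_cst.
- exact: measurable_tnth.
- exact: measurable_realfun.measurable_funD.
- exact: measurable_realfun.measurable_funM.
Qed.

Lemma measurable_polyfun0 f : polyfun f -> measurable [set t | f t = 0].
Proof.
move=> /measurable_polyfun mf.
have := mf measurableT [set 0] (measurable_set1 _).
by rewrite setTI.
Qed.

End polyfun_theory.

Lemma countable_root (R : idomainType) (p : {poly R}) :
  p != 0 -> countable [set x | root p x].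
Proof.
move=> p0; apply: finite_set_countable; apply: contrapT.
move=> /(infinite_set_fset (size p))[B Bp].
apply/negP; rewrite -ltnNge; apply: max_poly_roots p0 _ (finmap.fset_uniq B).
by apply/allP => x /Bp.
Qed.

(** Supplies the one-variable polynomial whose roots are the exceptional first coordinates in the
    Fubini argument. *)
Lemma polyfun_consl (R : realType) n
    (f : n.+1.-tuple (measurableTypeR R) -> R) t :
  polyfun f -> exists p : {poly R}, forall x, f (tuple_cons (x, t)) = p.[x].
Proof.
elim=> {f}[c|i|f g _ [p pE] _ [q qE]|f g _ [p pE] _ [q qE]].
- by exists c%:P => x; rewrite hornerC.
- case: (unliftP ord0 i) => [k ->|->].
    by exists (tnth t k)%:P => x; rewrite hornerC tnthS.
  by exists 'X => x; rewrite hornerX.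
- by exists (p + q) => x; rewrite hornerD pE qE.
- by exists (p * q) => x; rewrite hornerM pE qE.
Qed.

Lemma polyfun_consr (R : realType) n
    (f : n.+1.-tuple (measurableTypeR R) -> R) x :
  polyfun f -> polyfun (fun t => f (tuple_cons (x, t))).
Proof.
elim=> {f}[c|i|f g _ pf _ pg|f g _ pf _ pg].
- exact: polyfun_cst.
- case: (unliftP ord0 i) => [k ->|->].
    rewrite (_ : (fun _ => _) = fun t => tnth t k); first exact: polyfun_tnth.
    by apply/funext => t; rewrite tnthS.
  rewrite (_ : (fun _ => _) = fun=> x); first exact: polyfun_cst.
  by apply/funext.
- exact: polyfunD.
- exact: polyfunM.
Qed.

(* By Fubini: for all but finitely many values of the first coordinate the
   section of [f] does not vanish identically. *)
Lemma lebesgue_tuple_polyfun0 (R : realType) n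
    (f : n.-tuple (measurableTypeR R) -> R) t0 :
  polyfun f -> f t0 != 0 -> lebesgue_tuple R n [set t | f t = 0] = 0%E.
Proof.
elim: n => [|n IHn] in f t0 *.
  (* In dimension zero the measure is the Dirac mass at the empty tuple, which is [t0]. *)
  move=> _ ft0; rewrite /= diracE memNset// => /= f0.
  by move: ft0; rewrite (tuple0 t0) f0 eqxx.
move=> pf ft0.
have mA : measurable (@tuple_cons R n @^-1` [set t | f t = 0]).
  rewrite -[X in measurable X]setTI; apply: measurable_tuple_cons => //.
  exact: measurable_polyfun0.
have t0E : t0 = tuple_cons (tuple_uncons t0).
  by apply/val_inj; case/tupleP: t0 ft0 => x t _.
move: ft0; rewrite t0E; case: (tuple_uncons t0) => x0 s0 ft0.
rewrite /= /lebesgue_tuple_step /pushforward /product_measure1.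
(* The measure is now an integral of section measures over the first coordinate; these need only
   vanish almost everywhere. *)
rewrite (@ge0_ae_eq_integral _ _ _ _ _ _ (cst 0%E))//.
- by rewrite integral0.
- exact: measurable_fun_xsection.
(* Along the fixed tail [s0], [f] is a polynomial [p] with [p.[x0] != 0]. Away from the roots of [p]
   the section of [f] is nonzero at [s0], and induction applies. *)
have [p pE] := polyfun_consl s0 pf.
have p0 : p != 0 by apply: contraNneq ft0 => p0; rewrite pE p0 horner0.
exists [set x | root p x]; split.
- by apply: countable_measurable => //; exact: countable_root.
- exact: countable_lebesgue_measure0 (countable_root p0).
- move=> x /= xN; apply/rootP; rewrite -pE; apply: contrapT => /eqP fx.
  apply: xN => _; rewrite xsectionE.
  by apply: (IHn (fun t => f (tuple_cons (x, t))) s0) => //; exact: polyfun_consr.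
Qed.

(** * Matrix form of the Schrodinger operator *)

Section schrodinger_matrix.
Variables (F : comNzRingType) (V : finType) (e : rel V).

(** Degree matrix minus adjacency matrix, over a general ring so that it can be carried from [R] to
    [R[i]]. *)
Definition laplacian_mx : 'M[F]_#|V| :=
  \matrix_(i, k) ((\sum_(l | e (enum_val i) l) 1) *+ (i == k)
                  - (e (enum_val i) (enum_val k))%:R).

Lemma schrodinger_mxE (Q : V -> F) (u : {ffun V -> F}) i :
  schrodinger e Q u (enum_val i) =
  ((laplacian_mx + diag_mx (\row_i Q (enum_val i))) *m
    \col_i u (enum_val i)) i 0.
Proof.
rewrite !ffunE mulmxDl mul_diag_mx [RHS]mxE.
congr (_ + _); last by rewrite !mxE.
rewrite sumrB mxE.
under [RHS]eq_bigr do rewrite !mxE mulrBl.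
rewrite sumrB (bigD1 i)//= eqxx mulr1n [X in _ + X - _]big1 => [|l /negbTE li].
  rewrite addr0 mulr_suml; congr (_ - _).
    by apply: eq_bigr => l _; rewrite mul1r.
  rewrite big_mkcond (reindex_onto enum_val enum_rank)/= => [|k _]; last first.
    by rewrite enum_rankK.
  apply: eq_big => l; rewrite ?enum_valK ?eqxx// => _.
  by case: ifP; rewrite ?mul1r ?mul0r.
by rewrite eq_sym li mulr0n mul0r.
Qed.

End schrodinger_matrix.

Lemma map_laplacian_mx (F K : comNzRingType) (f : {rmorphism F -> K})
    (V : finType) (e : rel V) : map_mx f (laplacian_mx F e) = laplacian_mx K e.
Proof.
apply/matrixP => i k; rewrite !mxE rmorphB rmorph_nat rmorphMn rmorph_sum.
by under eq_bigr do rewrite rmorph1.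
Qed.

(** * The null set of potentials attached to a vertex *)

Section lebesgue_ae_schrodinger.
Variables (R : realType) (V : finType) (e : rel V).

(** Observability is obtained over the algebraically closed [R[i]]; since the potential found has
    natural values, its Krylov determinant is the image of a real one. *)
Lemma det_krylov_schrodinger_neq0 (j : V) :
  symmetric e -> (forall x y : V, connect e x y) ->
  exists t0 : #|V|.-tuple (measurableTypeR R),
    \det (krylov_mx (laplacian_mx R e + diag_mx (\row_i tnth t0 i))
            (enum_rank j)) != 0.
Proof.
move=> e_sym e_conn.
have [S jS ST|Q /det_krylov_neq0 Q0] :=
    @exists_observable R[i] _ (laplacian_mx R[i] e) (enum_rank j).
  (* If no edge left [S], it would be closed under adjacency, hence everything by connectedness. *)
  apply: contrapT => noedge; move/negP: ST; apply.
  apply/eqP/finset.setP => i; rewrite inE.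
  pose a := [pred x | enum_rank x \in S].
  have clS : fingraph.closed e a.
    apply: (intro_closed (sym_connect_sym e_sym)) => x y exy /= xS.
    apply: contrapT => /negP yS; apply: noedge.
    exists (enum_rank x), (enum_rank y); split=> //.
    have /negbTE xy : enum_rank x != enum_rank y.
      by apply: contraNneq yS => xy; rewrite inE /= -xy.
    by rewrite mxE !enum_rankK exy xy mulr0n sub0r oppr_eq0 oner_eq0.
  have := closed_connect clS (e_conn j (enum_val i)).
  by rewrite !inE enum_valK jS => <-.
exists [tuple (Q i)%:R | i < #|V|].
rewrite -(fmorph_eq0 (real_complex R)) -det_map_mx; apply: contraNneq Q0 => <-.
rewrite map_krylov_mx map_mxD map_diag_mx map_laplacian_mx.
set q := map_mx _ _; rewrite (_ : q = \row_i (Q i)%:R)//; apply/rowP => i.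
by rewrite !mxE tnth_mktuple rmorph_nat.
Qed.

Lemma polyfun_det_krylov (j : V) :
  polyfun (fun t : #|V|.-tuple (measurableTypeR R) =>
    \det (krylov_mx (laplacian_mx R e + diag_mx (\row_i tnth t i))
            (enum_rank j))).
Proof.
apply: polyfun_det => k i; under eq_fun do rewrite mxE.
elim: (k : nat) i => [|m IHm] i.
  by under eq_fun do rewrite mxE; exact: polyfun_cst.
under eq_fun do rewrite exprSr mxE.
apply: polyfun_sum => l; apply: polyfunM => //.
under eq_fun do rewrite mxE; apply: polyfunD; first exact: polyfun_cst.
under eq_fun do rewrite !mxE.
by case: eqP => _; [exact: polyfun_tnth|exact: polyfun_cst].
Qed.

Lemma ae_eigenvector_neq0 (j : V) :
  symmetric e -> (forall x y : V, connect e x y) ->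
  lebesgue_ae (fun Q : V -> R => forall u : {ffun V -> R[i]},
    is_eigenvector (schrodingerC e Q) u -> u j != 0).
Proof.
move=> e_sym e_conn.
have [t0 t0P] := det_krylov_schrodinger_neq0 j e_sym e_conn.
have pf := polyfun_det_krylov j.
exists [set t | \det (krylov_mx (laplacian_mx R e + diag_mx (\row_i tnth t i))
                        (enum_rank j)) = 0]; split.
- exact: measurable_polyfun0.
- exact: lebesgue_tuple_polyfun0 t0P.
- move=> t /= tN; apply: contrapT => /eqP t0'; apply: tN => u [u0 [lam uE]].
  apply: contraNneq t0' => uj.
  (* The determinant is real while [u] and [lam] are over [R[i]], so it is first mapped there. *)
  rewrite -(fmorph_eq0 (real_complex R)) -det_map_mx map_krylov_mx.
  rewrite map_mxD map_diag_mx map_laplacian_mx.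
  apply/eqP; apply: (@det_krylov_eq0 _ _ _ _ lam (\col_i u (enum_val i))).
  + set q := map_mx _ _.
    have -> : q = \row_i (tnth t (enum_rank (enum_val i)))%:C%C.
      by apply/rowP => i; rewrite !mxE enum_valK.
    apply/colP => i; rewrite [RHS]mxE [X in _ = _ * X]mxE -uE.
    by rewrite /schrodingerC schrodinger_mxE.
  + by rewrite mxE enum_rankK.
  + apply: contra_neq u0 => u0; apply/ffunP => v.
    by move/colP/(_ (enum_rank v)): u0; rewrite !mxE enum_rankK ffunE.
Qed.

End lebesgue_ae_schrodinger.

Theorem proposition3p6 (R : realType) (V : finType) (e : rel V)
    (e_sym : symmetric e) (e_irr : irreflexive e)
    (e_conn : forall x y : V, connect e x y) :
  lebesgue_ae (fun Q : V -> R =>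
    forall u : {ffun V -> R[i]},
      is_eigenvector (schrodingerC e Q) u -> full_support u) /\
  lebesgue_ae (fun Q : V -> R => condition_S (schrodinger e Q)).
Proof.
have aeF : Filter (almost_everywhere (lebesgue_tuple R #|V|)).
  exact: ae_filter_ringOfSetsType.
have ae_full : lebesgue_ae (fun Q : V -> R => forall u : {ffun V -> R[i]},
    is_eigenvector (schrodingerC e Q) u -> full_support u).
  (* There are finitely many vertices, so the conditions hold simultaneously almost everywhere. *)
  have := filter_forall aeF (fun j : V => ae_eigenvector_neq0 R j e_sym e_conn).
  by apply: filterS => Q QP u uP j; exact: QP.
split=> //; move: ae_full; apply: filterS => Q full phi [_ phiE] k l _.
suff phi0 m j : phi m j != 0.
  (* Any vertex would do; the index [k] provides one. *)
  by exists (enum_val k); rewrite mulf_neq0.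
have [phim0 [lam phimE]] := phiE m.
(* The real eigenvector is viewed over [R[i]], where full support is known. *)
pose u : {ffun V -> R[i]} := [ffun v => real_complex R (phi m v)].
have /full/(_ j) : is_eigenvector (schrodingerC e Q) u.
  split.
    apply: contra_neq phim0 => /ffunP u0; apply/ffunP => v.
    apply: (fmorph_inj (real_complex R)).
    by have := u0 v; rewrite !ffunE rmorph0.
  exists (real_complex R lam) => v; rewrite [u v]ffunE -rmorphM -phimE !ffunE.
  rewrite rmorphD rmorphM rmorph_sum; congr (_ + _).
  by apply: eq_bigr => w _; rewrite !ffunE rmorphB.
by rewrite ffunE fmorph_eq0.
Qed.
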